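(* Let $d\in\mathbb R$ be arbitrary. (1) Let $F^\star\subset\mathcal E$ be a dual surface, i.e. a two-parameter family of planes $\phi(\mathbf n(u,v),e(u,v))$ with $\mathbf n(u,v)\in S^2$, $e(u,v)\in\mathbb R$; let $F_d^\star=o^\star(F^\star)$ be the family of planes of its offset at distance $d$, and let $G=\alpha(F^\star)$. Then $\alpha$ maps $F_d^\star$ to $G_d=\alpha(F_d^\star)=c(G)$, the conchoid surface of $G$ at distance $d$ with respect to the reference point $O$ of $\alpha$. That is, the diagram with horizontal maps $\alpha:F^\star\to G$, $\alpha:F_d^\star\to G_d$ and vertical maps $o^\star:F^\star\to F_d^\star$, $c:G\to G_d$ commutes: $\alpha\circ o^\star=c\circ\alpha$. (2) Likewise, let $G\subset\mathcal P$ be a surface with points $\gamma(\mathbf s(u,v),r(u,v))$, and let $G_d=c(G)$ be its conchoid surface at distance $d$ with respect to $O$. Then $\alpha^\star$ maps the family of conchoid surfaces $G_d$ to a family of offset surfaces: with $F^\star=\alpha^\star(G)$ one has $\alpha^\star(G_d)=F_d^\star=o^\star(F^\star)$, and the diagram with horizontal maps $\alpha^\star:G\to F^\star$, $\alpha^\star:G_d\to F_d^\star$ and vertical maps $o^\star$, $c$ commutes: $\alpha^\star\circ c=o^\star\circ\alpha^\star$ (at points where the occurring values of $\alpha^\star$ are defined).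
   Context: $\mathcal P$ is the set of points of $\mathbb R^3$, $\mathcal E$ the set of planes of $\mathbb R^3$, $O$ is the origin, $S^2$ the unit sphere. Parametrizations: $\phi:S^2\times\mathbb R\to\mathcal E$ sends $(\mathbf n,e)$ to the plane $\{\mathbf x:\mathbf n\cdot\mathbf x=e\}$; $\gamma:S^2\times\mathbb R\to\mathcal P$ sends $(\mathbf s,r)$ to the point $r\mathbf s$. A surface $F$ is regarded as the envelope of its tangent planes, which form its dual surface $F^\star\subset\mathcal E$, locally parametrized through $\phi$; a surface $G$ is regarded as a set of points, locally parametrized through $\gamma$ (polar representation). The offset map with offset distance $d$ is $o^\star:\phi(\mathbf n,e)\mapsto\phi(\mathbf n,e+d)$. The conchoidal map is $c:\gamma(\mathbf s,r)\mapsto\gamma(\mathbf s,r+d)$. Since $\phi(\mathbf n,e)=\phi(-\mathbf n,-e)$ and $\gamma(\mathbf s,r)=\gamma(-\mathbf s,-r)$, these maps are understood as acting on objects together with a chosen representing pair in $S^2\times\mathbb R$ (a choice of orientation); the maps $\alpha$ and $\alpha^\star$ are understood to transport the representing pair unchanged (the plane represented by $(\mathbf n,e)$ corresponds to the point represented by $(\mathbf n,e)$). The foot-point map with respect to $O$ is $\alpha:\mathcal E\to\mathcal P$, $\{\mathbf x\cdot\mathbf n=e\}\mapsto\frac{e}{\|\mathbf n\|^2}\mathbf n$ (here $\mathbf n\neq0$ need not be a unit vector). The inverse map is $\alpha^\star:\mathcal P\setminus\{O\}\to\mathcal E$, $\mathbf p\mapsto\{\mathbf x:\mathbf x\cdot\mathbf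 p=\mathbf p\cdot\mathbf p\}$. *)

(* Defs.v *)
From mathcomp Require Import all_boot all_order all_algebra.
From mathcomp Require Import boolp classical_sets reals.

Set Implicit Arguments.
Unset Strict Implicit.
Unset Printing Implicit Defensive.

Import Order.TTheory GRing.Theory Num.Theory.
Local Open Scope ring_scope.
Local Open Scope classical_set_scope.

(* Oriented planes and oriented points are modelled as an underlying object
   (a plane as a set of points, or a point) paired with a representative in
   S^2 x R. The offset and conchoidal maps act through the representative,
   whereas the foot-point map and its inverse act on the underlying object
   only and copy the representative. That the copied representative still
   represents the image is not built into the types: the predicates
   [oriented_plane] and [oriented_point] express it. *)

Section FootPoint.
Variable R : realType.

Definition point := 'rV[R]_3.

Definition dot (x y : point) : R := \sum_(i < 3) x 0 i * y 0 i.

(* The Euclidean norm; the norm [`|x|] of MathComp-Analysis on matrices is the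
   sup norm. *)
Definition enorm (x : point) : R := Num.sqrt (dot x x).

Definition S2 := {n : point | enorm n == 1}.

Definition plane (n : point) (e : R) : set point := [set x | dot n x = e].

Definition phi (q : S2 * R) : set point := plane (val q.1) q.2.

Definition gamma (q : S2 * R) : point := q.2 *: val q.1.

(* The value does not depend on which equation n.x = e of the plane E is
   chosen; it is 0 by convention when E is not a plane. *)
Definition alpha (E : set point) : point :=
  xget 0 [set p | exists n e,
    [/\ n != 0, E = plane n e & p = (e / enorm n ^+ 2) *: n]].

(* Only meaningful for p != 0: at p = 0 this is the whole space. *)
Definition alpha_star (p : point) : set point := [set x | dot x p = dot p p].

Definition oplane : Type := set point * (S2 * R).
Definition opoint : Type := point * (S2 * R).

Definition oriented_plane : set oplane := [set E | E.1 = phi E.2].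
Definition oriented_point : set opoint := [set p | p.1 = gamma p.2].

Definition shift (d : R) (q : S2 * R) : S2 * R := (q.1, q.2 + d).

Definition offset (d : R) (E : oplane) : oplane :=
  (phi (shift d E.2), shift d E.2).

Definition conchoid (d : R) (p : opoint) : opoint :=
  (gamma (shift d p.2), shift d p.2).

Definition oalpha (E : oplane) : opoint := (alpha E.1, E.2).
Definition oalpha_star (p : opoint) : oplane := (alpha_star p.1, p.2).

Definition dual_surface (D : set (R * R)) (n : R * R -> S2) (e : R * R -> R) :
    set oplane :=
  [set (phi (n w, e w), (n w, e w)) | w in D].

Definition point_surface (D : set (R * R)) (s : R * R -> S2) (r : R * R -> R) :
    set opoint :=
  [set (gamma (s w, r w), (s w, r w)) | w in D].

End FootPoint.

(* Main.v *)
(** A plane determines its foot point: if p and p' both lie on the plane and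
    both satisfy p.x = p.p for every x on it, then p.p = p.p' = p'.p', so
    p = p'. Hence [alpha] sends phi(n, e) to gamma(n, e), and conversely
    [alpha_star] sends gamma(s, r) to phi(s, r) when r != 0; in these
    coordinates both vertical maps are the same shift of the second
    component. *)
Require Import Defs.
From mathcomp Require Import all_boot all_order all_algebra.
From mathcomp Require Import boolp classical_sets reals.

Local Open Scope ring_scope.
Local Open Scope classical_set_scope.

Import GRing.Theory Num.Theory.

Section FootPoint.
Set Implicit Arguments.
Unset Strict Implicit.
Context {R : realType}.
Implicit Types (x y n : 'rV[R]_3) (e : R) (q : S2 R * R).

Lemma dotC x y : dot x y = dot y x.
Proof. by apply: eq_bigr => i _; rewrite mulrC. Qed.

Lemma dotZl a x y : dot (a *: x) y = a * dot x y.
Proof. by rewrite mulr_sumr; apply: eq_bigr => i _; rewrite mxE mulrA. Qed.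

Lemma dotZr a x y : dot x (a *: y) = a * dot x y.
Proof. by rewrite dotC dotZl dotC. Qed.

Lemma dotBl x y z : dot (x - y) z = dot x z - dot y z.
Proof. by rewrite -sumrB; apply: eq_bigr => i _; rewrite !mxE mulrBl. Qed.

Lemma dot_ge0 x : 0 <= dot x x.
Proof. by apply: sumr_ge0 => i _; rewrite -expr2 sqr_ge0. Qed.

Lemma dot_eq0 x : (dot x x == 0) = (x == 0).
Proof.
apply/eqP/eqP => [x0 | ->]; last by rewrite -(scale0r 0) dotZl mul0r.
apply/rowP => i; rewrite mxE; apply/eqP; rewrite -sqrf_eq0 expr2.
by apply/eqP/(psumr_eq0P _ x0) => // j _; rewrite -expr2 sqr_ge0.
Qed.

Lemma sqr_enorm x : enorm x ^+ 2 = dot x x.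
Proof. by rewrite sqr_sqrtr // dot_ge0. Qed.

Lemma dot_S2 (s : S2 R) : dot (val s) (val s) = 1.
Proof. by rewrite -sqr_enorm (eqP (valP s)) expr1n. Qed.

Lemma S2_neq0 (s : S2 R) : val s != 0.
Proof. by rewrite -dot_eq0 dot_S2 oner_eq0. Qed.

Lemma plane_foot n e : n != 0 -> plane n e ((e / enorm n ^+ 2) *: n).
Proof.
by move=> n0; rewrite /plane /= dotZr sqr_enorm divfK // dot_eq0.
Qed.

(** The foot point is a multiple of [n], so its product with [x] depends only on [dot n x], which is
    [e] on the whole plane, the foot point included. *)
Lemma dot_foot n e x : n != 0 -> plane n e x ->
  let p := (e / enorm n ^+ 2) *: n in dot p x = dot p p.
Proof.
by move=> n0 nx /=; rewrite !dotZl nx (plane_foot e n0).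
Qed.

Lemma foot_uniq n e n' e' : n != 0 -> n' != 0 -> plane n e = plane n' e' ->
  (e / enorm n ^+ 2) *: n = (e' / enorm n' ^+ 2) *: n'.
Proof.
move=> n0 n'0 E.
have Pp := plane_foot e n0; have Pp' := plane_foot e' n'0.
rewrite -E in Pp'; have pp' := dot_foot n0 Pp'.
rewrite E in Pp; have p'p := dot_foot n'0 Pp.
move: pp' p'p => /=; set p := _ *: n; set p' := _ *: n' => pp' p'p.
(* The squared length of [p - p'] expands into four products, all equal to [dot p' p'], which
   cancel. *)
apply/eqP; rewrite -subr_eq0 -dot_eq0 dotBl !(dotC _ (p - p')) !dotBl.
by rewrite p'p -pp' (dotC p) p'p !subrr.
Qed.

(** By [foot_uniq] the choice made by [xget] is independent of the equation; the given equation is a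
    witness that excludes the default value 0. *)
Lemma alpha_plane n e : n != 0 -> alpha (plane n e) = (e / enorm n ^+ 2) *: n.
Proof.
move=> n0; rewrite /alpha.
case: xgetP => [p _ [n' [e' [n'0 /(foot_uniq n0 n'0) -> ->]]] // | noP].
by case: (noP ((e / enorm n ^+ 2) *: n)); exists n, e.
Qed.

Lemma alpha_phi q : alpha (phi q) = gamma q.
Proof. by rewrite alpha_plane ?S2_neq0 // sqr_enorm dot_S2 divr1. Qed.

(** For [gamma q] = r s with s a unit vector, the equation becomes r (s.x) = r r, and r can be
    cancelled. *)
Lemma alpha_star_gamma q : gamma q != 0 -> alpha_star (gamma q) = phi q.
Proof.
rewrite scaler_eq0 negb_or => /andP[r0 _].
apply/seteqP; split=> x; rewrite /alpha_star /phi /plane /gamma /=;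
  rewrite dotZl !dotZr dot_S2 mulr1 dotC.
  exact: mulfI.
by move->.
Qed.

Lemma oalpha_phi q : oalpha (phi q, q) = (gamma q, q).
Proof. by rewrite /oalpha alpha_phi. Qed.

Lemma oalpha_star_gamma q :
  gamma q != 0 -> oalpha_star (gamma q, q) = (phi q, q).
Proof. by move=> q0; rewrite /oalpha_star alpha_star_gamma. Qed.

End FootPoint.

Lemma image_square {T U V W} (A : set T) (f : T -> U) (g : U -> W)
    (h : T -> V) (k : V -> W) :
  (forall x, A x -> g (f x) = k (h x)) -> g @` (f @` A) = k @` (h @` A).
Proof. by move=> fghk; rewrite !image_comp; apply: eq_imagel. Qed.

Theorem theorem4 (R : realType) (d : R) :
  (forall (D : set (R * R)) (n : R * R -> S2 R) (e : R * R -> R),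
    let F := dual_surface D n e in
    let Fd := offset d @` F in
    let G := @oalpha R @` F in
    let Gd := @oalpha R @` Fd in
    [/\ G `<=` @oriented_point R,
        Gd `<=` @oriented_point R,
        Gd = conchoid d @` G
      & forall E, F E -> oalpha (offset d E) = conchoid d (oalpha E)])
  /\
  (forall (D : set (R * R)) (s : R * R -> S2 R) (r : R * R -> R),
    let G := point_surface D s r in
    let Gd := conchoid d @` G in
    (* the points of G at which both occurring values of alpha_star exist *)
    let G' := [set p | [/\ G p, p.1 != 0 & (conchoid d p).1 != 0]] in
    [/\ forall p, (G `|` Gd) p -> p.1 != 0 -> oriented_plane (oalpha_star p),
        forall p, G' p ->
          oalpha_star (conchoid d p) = offset d (oalpha_star p),
        @oalpha_star R @` (conchoid d @` G') =
          offset d @` (@oalpha_star R @` G')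
      & (forall p, (G `|` Gd) p -> p.1 != 0) ->
        let F := @oalpha_star R @` G in
        let Fd := offset d @` F in
        @oalpha_star R @` Gd = Fd]).
Proof.
split=> D s r.
  have sq E : dual_surface D s r E ->
      oalpha (offset d E) = conchoid d (oalpha E).
    (* [conchoid] reads only the representative, which [oalpha] copies, so the square reduces by
       computation to [oalpha_phi] at the shifted representative. *)
    by case=> w _ <-; exact: oalpha_phi.
  split=> //.
  - by move=> _ [_ [w _ <-] <-]; rewrite oalpha_phi.
  - by move=> _ [_ [E _ <-] <-]; rewrite oalpha_phi.
  - exact: image_square.
move=> G Gd G'.
have sq p : G' p -> oalpha_star (conchoid d p) = offset d (oalpha_star p).
  by case=> _ _; exact: oalpha_star_gamma.
split=> // [p | | nz F Fd].
- by case=> [[w _ <-] | [q _ <-]] p0; rewrite oalpha_star_gamma.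
- exact: image_square.
(* If neither [G] nor [Gd] meets the origin, every point of [G] lies in [G']. *)
- apply: image_square => p Gp; apply: sq; split=> //; apply: nz; first by left.
  by right; exists p.
Qed.
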